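(* Let $Z\subseteq X$ be an irreducible component and let $\mu\in U^\circ(\Bbbk)$, where $U^\circ\subseteq (Z_{\mathrm{red}})_{\mathrm{sm}}$ is the principal constant-rank locus of $Z$. If $H^2_{\mathrm{inc}}(\mu)=0$, then $G\cdot\mu$ is Zariski open in $Z_{\mathrm{red}}$.
   Context: $\Bbbk$ is an algebraically closed field of characteristic $0$, $W$ is a finite-dimensional $\Bbbk$-vector space, and $G=\mathrm{GL}(W)$ acts on $\mathrm{Hom}_\Bbbk(W\otimes W,W)$ by $(g\cdot\mu)(x,y)=g\,\mu(g^{-1}x,g^{-1}y)$; $\mathfrak g=\mathrm{Lie}(G)=\mathrm{End}(W)$. $A_W$ denotes one of the $G$-representations $\mathrm{Hom}(W^{\otimes 2},W)$, $\mathrm{Hom}(\mathrm{Sym}^2W,W)$, $\mathrm{Hom}(\Lambda^2W,W)$, also viewed as an affine space. $Q\subseteq \mathrm{Sym}^2(A_W^\vee)$ is a fixed $G$-stable subspace; each $q\in Q$ is regarded as a symmetric bilinear form on $A_W$, with $f_q(\nu)=q(\nu,\nu)$. $X=\mathrm{Var}(Q)\subseteq A_W$ is the closed subscheme defined by $f_q=0$, $q\in Q$. For $\mu\in X$ put $\Phi_\mu\colon A_W\to Q^\vee$, $\Phi_\mu(\nu)(q)=q(\mu,\nu)$, and $\delta_\mu\colon\mathfrak g\to A_W$, $\delta_\mu(\xi)=\xi\cdot\mu$ (infinitesimal action). One has $\Phi_\mu\circ\delta_\mu=0$ and $H^2_{\mathrm{inc}}(\mu)=\ker(\Phi_\mu)/\mathrm{im}(\delta_\mu)$.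 For an irreducible component $Z$ of $X$, $Z_{\mathrm{red}}$ is its reduced subscheme and $U=(Z_{\mathrm{red}})_{\mathrm{sm}}$ its smooth locus. Let $r_Z$ and $d_Z$ be the generic (equivalently, maximal) values of $\mathrm{rank}(\Phi_\mu)$ and $\mathrm{rank}(\delta_\mu)$ for $\mu\in U$. The principal constant-rank locus is $U^\circ=\{\mu\in U\mid \mathrm{rank}(\Phi_\mu)=r_Z,\ \mathrm{rank}(\delta_\mu)=d_Z\}$, a dense open subset of $U$. *)

(* Defs.v *)
From HB Require Import structures.
From mathcomp Require Import all_boot all_order all_algebra.
From mathcomp Require Import boolp classical_sets.
From mathcomp Require Import mpoly.

Set Implicit Arguments.
Unset Strict Implicit.
Unset Printing Implicit Defensive.

Import GRing.Theory.
Local Open Scope ring_scope.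
Local Open Scope classical_set_scope.

Section Bilinear.
Variable k : fieldType.

Lemma linfun_lin (U T : vectType k) (f : U -> T) : linear f -> linfun f =1 f.
Proof.
move=> lf x.
pose fl := HB.pack_for {linear U -> T} f (GRing.isLinear.Build k U T *:%R f lf).
exact: (lfunE fl x).
Qed.

(* [linfun] is only meaningful on linear functions, hence [bilin] on bilinear
   ones: see [bilinE]. *)
Definition bilin (U V T : vectType k) (f : U -> V -> T) : 'Hom(U, 'Hom(V, T)) :=
  linfun (fun u => linfun (f u)).

Lemma bilinE (U V T : vectType k) (f : U -> V -> T) :
  (forall u, linear (f u)) -> (forall v, linear (f^~ v)) ->
  forall u v, bilin f u v = f u v.
Proof.
move=> lr ll u v; rewrite /bilin linfun_lin ?linfun_lin //.
move=> a x y; apply/lfunP => w.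
by rewrite add_lfunE scale_lfunE !linfun_lin // ll.
Qed.

Lemma lin3 (U : vectType k) (a : k) (x1 y1 x2 y2 x3 y3 : U) :
  a *: x1 + y1 - (a *: x2 + y2) - (a *: x3 + y3) =
  a *: (x1 - x2 - x3) + (y1 - y2 - y3).
Proof.
by rewrite !scalerBr !opprD [X in X + _ = _]addrACA [LHS]addrACA.
Qed.

Definition lfun_rank (U T : vectType k) (f : 'Hom(U, T)) : nat := \dim (limg f).

End Bilinear.

Section Zariski.
Variables (k : fieldType) (V : vectType k).

Local Notation dimV := (\dim {:V}).

Definition coords (v : V) (i : 'I_dimV) : k := coord (vbasis {:V}) i v.

Definition peval (p : {mpoly k[dimV]}) (v : V) : k := p.@[coords v].

Definition zero_locus (S : set {mpoly k[dimV]}) : set V :=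
  [set v | forall p, S p -> peval p v = 0].

Definition zclosed (C : set V) : Prop := exists S, C = zero_locus S.

Definition zopen (O : set V) : Prop := zclosed (~` O).

Definition zopen_in (Z B : set V) : Prop :=
  exists2 O : set V, zopen O & B = O `&` Z.

Definition zirreducible (Z : set V) : Prop :=
  Z !=set0 /\
  (forall C1 C2 : set V, zclosed C1 -> zclosed C2 ->
     Z `<=` C1 `|` C2 -> Z `<=` C1 \/ Z `<=` C2).

Definition irreducible_component (X Z : set V) : Prop :=
  [/\ Z `<=` X, zirreducible Z &
      forall Z' : set V, Z' `<=` X -> zirreducible Z' -> Z `<=` Z' -> Z' = Z].

(* Z_0 < Z_1 < ... < Z_n irreducible closed subsets of Z *)
Definition has_chain (Z : set V) (n : nat) : Prop :=
  exists C : nat -> set V,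
    (forall i, (i <= n)%N -> [/\ zclosed (C i), zirreducible (C i) & C i `<=` Z])
    /\ (forall i, (i < n)%N -> C i `<` C i.+1).

Definition krull_dim (Z : set V) (n : nat) : Prop :=
  has_chain Z n /\ (forall m, has_chain Z m -> (m <= n)%N).

(* All polynomials vanishing on Z are used, so this is the Zariski tangent
   space of the reduced subscheme. *)
Definition tangent_vector (Z : set V) (mu v : V) : Prop :=
  forall p : {mpoly k[dimV]}, (forall z, Z z -> peval p z = 0) ->
    \sum_(i < dimV) peval p^`M(i) mu * coords v i = 0.

(* Jacobian criterion: the smooth points of an irreducible closed Z over an
   algebraically closed field are those with dim T_mu Z = dim Z. *)
Definition smooth_locus (Z : set V) : set V :=
  [set mu | Z mu /\
    exists2 T : {vspace V}, (forall v, v \in T <-> tangent_vector Z mu v) &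
                            krull_dim Z (\dim T)].

End Zariski.

Section Algebras.
Variables (k : fieldType) (W : vectType k).

(* Hom(W (x) W, W), curried *)
Definition bilop := 'Hom(W, 'Hom(W, W)).

Definition GL : set 'End(W) := [set g | lker g == 0%VS].

Definition bilop_act (g : 'End(W)) (mu : bilop) : bilop :=
  bilin (fun x y => g (mu (g^-1%VF x) (g^-1%VF y))).

(* derivative at the identity of g |-> bilop_act g mu in the direction xi *)
Definition bilop_inf_act (xi : 'End(W)) (mu : bilop) : bilop :=
  bilin (fun x y => xi (mu x y) - mu (xi x) y - mu x (xi y)).

Lemma bilop_actE g mu x y :
  bilop_act g mu x y = g (mu (g^-1%VF x) (g^-1%VF y)).
Proof.
apply: bilinE => [u|v] a b c /=; first by rewrite !linearP.
by rewrite !(linearP, add_lfunE, scale_lfunE).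
Qed.

Lemma bilop_inf_actE xi mu x y :
  bilop_inf_act xi mu x y = xi (mu x y) - mu (xi x) y - mu x (xi y).
Proof.
apply: bilinE => [u|v] a b c /=; first by rewrite -lin3 !linearP.
by rewrite -lin3 !(linearP, add_lfunE, scale_lfunE).
Qed.

(* A is Hom(W (x) W, W), Hom(Sym^2 W, W) or Hom(Lambda^2 W, W), the last two
   seen as the spaces of symmetric, resp. alternating, bilinear operations. *)
Definition is_AW (A : {vspace bilop}) : Prop :=
  [\/ A = fullv,
      (forall mu : bilop, mu \in A <-> forall x y, mu x y = mu y x)
    | (forall mu : bilop, mu \in A <-> forall x, mu x x = 0)].

Lemma bilop_act_stable A g (mu : bilop) :
  is_AW A -> mu \in A -> bilop_act g mu \in A.
Proof.
case=> [-> _|h|h]; first exact: memvf.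
  by move=> /h mS; apply/h => x y; rewrite !bilop_actE mS.
by move=> /h mA; apply/h => x; rewrite bilop_actE mA linear0.
Qed.

Lemma bilop_inf_act_stable A xi (mu : bilop) :
  is_AW A -> mu \in A -> bilop_inf_act xi mu \in A.
Proof.
case=> [-> _|h|h]; first exact: memvf.
  move=> /h mS; apply/h => x y; rewrite !bilop_inf_actE.
  by rewrite (mS x y) (mS (xi x)) (mS x (xi y)) addrAC.
move=> /h mA; apply/h => x; rewrite bilop_inf_actE mA linear0 sub0r.
have := mA (x + xi x); rewrite !linearD /= !add_lfunE !mA add0r addr0.
by move=> e; rewrite -opprD e oppr0.
Qed.

End Algebras.

Section Deformation.
Variables (k : fieldType) (W : vectType k) (A : {vspace bilop W}).

(* The affine space A_W as a vector space in its own right. When [is_AW A], the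
   projections [vsproj A] below are applied to elements of A only. *)
Local Notation V := (subvs_of A).

Definition act (g : 'End(W)) (mu : V) : V := vsproj A (bilop_act g (vsval mu)).

Lemma val_act g mu : is_AW A -> vsval (act g mu) = bilop_act g (vsval mu).
Proof. by move=> hA; rewrite vsprojK ?bilop_act_stable ?subvsP. Qed.

Definition GL_orbit (mu : V) : set V := [set act g mu | g in @GL k W].

Definition delta (mu : V) : 'Hom('End(W), V) :=
  linfun (fun xi => vsproj A (bilop_inf_act xi (vsval mu))).

Lemma deltaE mu xi : is_AW A ->
  vsval (delta mu xi) = bilop_inf_act xi (vsval mu).
Proof.
move=> hA; rewrite linfun_lin ?vsprojK ?bilop_inf_act_stable ?subvsP //.
move=> a x y; rewrite -linearP; congr (vsproj A _).
apply/lfunP => u; apply/lfunP => v.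
rewrite add_lfunE scale_lfunE add_lfunE scale_lfunE !bilop_inf_actE -lin3.
by rewrite !(linearP, add_lfunE, scale_lfunE).
Qed.

Definition bilform := 'Hom(V, 'Hom(V, k^o)).

Definition symmetric_bilform (q : bilform) : Prop := forall mu nu, q mu nu = q nu mu.

Definition bilform_act (g : 'End(W)) (q : bilform) : bilform :=
  bilin (fun mu nu => q (act g^-1%VF mu) (act g^-1%VF nu)).

Lemma bilform_actE g q mu nu :
  bilform_act g q mu nu = q (act g^-1%VF mu) (act g^-1%VF nu).
Proof.
have actP h a x y : act h (a *: x + y) = a *: act h x + act h y.
  rewrite /act -linearP; congr (vsproj A _).
  apply/lfunP => u; apply/lfunP => v.
  by rewrite !(add_lfunE, scale_lfunE, bilop_actE, linearP).
apply: bilinE => [u|v] a b c /=; first by rewrite actP linearP.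
by rewrite actP linearP add_lfunE scale_lfunE.
Qed.

Variable Q : {vspace bilform}.

Definition GL_stable : Prop :=
  forall g q, @GL k W g -> q \in Q -> bilform_act g q \in Q.

(* k-points of Var(Q) *)
Definition VarQ : set V := [set mu | forall q, q \in Q -> q mu mu = 0].

Definition Phi (mu : V) : 'Hom(V, 'Hom(subvs_of Q, k^o)) :=
  bilin (fun nu (q : subvs_of Q) => vsval q mu nu).

Lemma PhiE mu nu q : Phi mu nu q = vsval q mu nu.
Proof.
apply: bilinE => [u|v] a b c /=; last by rewrite linearP.
by rewrite !(linearP, add_lfunE, scale_lfunE).
Qed.

(* The quotient ker(Phi_mu) / im(delta_mu) is represented, as usual for
   {vspace _}, by a complement of im(delta_mu) in ker(Phi_mu). *)
Definition H2inc (mu : V) : {vspace V} := (lker (Phi mu) :\: limg (delta mu))%VS.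

(* The r_Z and d_Z of the definition are the maximal values on the smooth
   locus U of the rank of Phi, resp. delta. *)
Definition max_value (U : set V) (f : V -> nat) (r : nat) : Prop :=
  (exists2 nu, U nu & f nu = r) /\ (forall nu, U nu -> (f nu <= r)%N).

Definition constant_rank_locus (Z : set V) : set V :=
  [set mu | let U := smooth_locus Z in
    [/\ U mu,
        max_value U (fun nu => lfun_rank (Phi nu)) (lfun_rank (Phi mu)) &
        max_value U (fun nu => lfun_rank (delta nu)) (lfun_rank (delta mu))]].

End Deformation.

(* Main.v *)
Require Import Defs.
From HB Require Import structures.
From mathcomp Require Import all_boot all_order all_algebra.
From mathcomp Require Import closed_field.
From mathcomp Require Import boolp classical_sets.
From mathcomp Require Import mpoly.

Set Implicit Arguments.
Unset Strict Implicit.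
Unset Printing Implicit Defensive.

Import GRing.Theory.
Local Open Scope ring_scope.

(** The hypothesis [H2inc = 0] says that [ker Phi_mu] lies in [im delta_mu]. A
tangent vector to [Z] at [mu] kills the differentials of all the [f_q], hence
lies in [ker Phi_mu] (characteristic 0 removes the factor 2), hence is a value
of the infinitesimal action. Smoothness of [Z] at [mu] therefore bounds the rank
of [delta_mu] below by [dim Z], and it remains to see that an orbit with so
large a differential is dense in [Z], and that a dense orbit is open.

Both steps replace the action, rational in [g], by the polynomial map
[(s, g) |-> s * adj(g) mu(g x, g y)], which sweeps exactly the orbit of [mu]
when [s * det g <> 0] ([param_map_orbit]). Adding the parameter [s] makes it
possible to choose polynomial families through [mu] whose partial derivatives
are prescribed values of [- delta_mu] ([orbit_map_directions]): the velocity of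
[s] compensates the trace term coming from the derivative of the adjugate.

Density is a dimension count made with explicit chains. Let [F] be a polynomial
map from [k^n] with linearly independent partial derivatives at 0. The closures
of [F (k^0)], [F (k^1)], up to [F (k^n)] form a strictly increasing chain of
irreducible closed sets ([has_chain_free_differential]): on [F (k^i)] any [i+1]
functions are algebraically dependent, by counting monomials
([algebraic_dependence]), while [i+1] coordinates dual to the partial
derivatives are algebraically independent on [F (k^(i+1))], by the Jacobian
criterion ([jacobian_independent]). With [n = dim Z], an orbit closure smaller
than [Z] would give [Z] a chain of length [n+1] ([orbit_dense]).

Openness is a case of Chevalley's theorem. Elimination of quantifiers over the
algebraically closed field [k] describes the orbit without quantifiers, so that
on the irreducible set [Z] it either contains or misses a nonempty open subset
([chevalley_generic]). The orbit being dense, it contains one, and its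
translates cover the orbit ([dense_orbit_open]). This uses the stability of [Z]
under [GL(W)], which holds because the union of the translates of [Z] is
irreducible ([component_act]). *)

(** * Evaluation and algebraic independence of polynomials *)

Lemma mpoly_ind_ring (R : comNzRingType) n (P : {mpoly R[n]} -> Prop) :
  (forall c, P c%:MP) -> (forall i, P 'X_i) ->
  (forall p q, P p -> P q -> P (p + q)) ->
  (forall p q, P p -> P q -> P (p * q)) -> forall p, P p.
Proof.
move=> PC PX PD PM p; rewrite (mpolyE p).
elim/big_ind: _ => [||m _]; [by rewrite -mpolyC0|exact: PD|].
rewrite -mul_mpolyC; apply: (PM) => //; rewrite mpolyXE_id.
elim/big_ind: _ => [||i _]; [by rewrite -mpolyC1|exact: (PM)|].
elim: (m i) => [|j IH]; first by rewrite expr0 -mpolyC1.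
by rewrite exprS; apply: (PM).
Qed.

Lemma mderivXU (R : comNzRingType) n (i l : 'I_n) :
  ('X_i : {mpoly R[n]})^`M(l) = ((i == l)%:R)%:MP.
Proof.
rewrite mderivX mnmE; case: eqP => [->|_]; last by rewrite scale0r mpolyC0.
by rewrite scale1r -[X in (X - _)%MM]add0m addmK mpolyX0.
Qed.

(** The chain rule, for an arbitrary derivation [d] of the target ring. It serves
below with [d] the derivation of {poly k} and with [d] a partial derivation of
{mpoly k[n]}. *)
Lemma mmap_chain (R S : comNzRingType) (h : {rmorphism R -> S}) n
    (y : 'I_n -> S) (d : {additive S -> S}) :
  (forall a b, d (a * b) = d a * b + a * d b) -> (forall c, d (h c) = 0) ->
  forall p, d (mmap h y p) = \sum_j mmap h y p^`M(j) * d (y j).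
Proof.
move=> dM dh; elim/mpoly_ind_ring => [c|i|p q IHp IHq|p q IHp IHq].
- rewrite mmapC dh big1 // => j _; by rewrite mderivC mmap0 mul0r.
- rewrite mmapX mmap1U (bigD1 i) //= big1 ?addr0 => [|j ji].
    by rewrite mderivXU eqxx mmapC /= rmorph_nat mulr_natl.
  by rewrite mderivXU eq_sym (negPf ji) mmapC /= rmorph_nat mulr_natl.
- rewrite raddfD /= raddfD /= IHp IHq -big_split; apply: eq_bigr => j _ /=.
  by rewrite mderivD raddfD /= mulrDl.
- rewrite rmorphM /= dM IHp IHq mulr_suml mulr_sumr -big_split /=.
  apply: eq_bigr => j _; rewrite mderivM raddfD /= !rmorphM /=.
  by rewrite mulrDl mulrAC mulrA.
Qed.


Lemma rmorph_mmap (R S T : comNzRingType) (h : {rmorphism R -> S})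
    (phi : {rmorphism S -> T}) n (y : 'I_n -> S) p :
  phi (mmap h y p) = mmap (phi \o h) (phi \o y) p.
Proof.
rewrite rmorph_sum; apply: eq_bigr => m _; rewrite rmorphM rmorph_prod.
by congr (_ * _); apply: eq_bigr => i _; rewrite rmorphXn.
Qed.

Section CharZero.
Variable k : fieldType.
Hypothesis char0 : [pchar k] =i pred0.

Lemma natr_pchar0_eq0 m : (m%:R == 0 :> k) = (m == 0)%N.
Proof. by move/pcharf0P: char0 => ->. Qed.

(** In characteristic 0 a nonzero polynomial can be differentiated down to a
nonzero constant. This is the common core of the two vanishing results below,
[meval_eq0] and [jacobian_independent]. *)
Lemma mderiv_closed_eq0 n (K : {mpoly k[n]} -> Prop) :
  (forall p j, K p -> K p^`M(j)) -> (forall c, K c%:MP -> c = 0) ->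
  forall p, K p -> p = 0.
Proof.
move=> Kd Kc p; have [d] : exists d, forall m, (d <= mdeg m)%N -> p@_m = 0.
  exists (msize p) => m /msize_mdeg_ge; rewrite mcoeff_msupp negbK.
  by move/eqP.
(* induction on a strict bound for the degrees of the monomials *)
elim: d p => [|d IH] p hd Kp; first by apply/mpolyP => m; rewrite hd ?mcoeff0.
have dp0 j : p^`M(j) = 0.
  apply: IH; last exact: Kd.
  by move=> m hm; rewrite mcoeff_deriv hd ?mul0rn // mdegD mdeg1 addn1.
have pm m : m != 0%MM -> p@_m = 0.
  move=> m0; have [j mj] : exists j, (0 < m j)%N.
    apply/existsP; apply: contraR m0; rewrite negb_exists => /forallP h.
    by apply/eqP/mnmP => j; rewrite mnm0E; have := h j; rewrite lt0n negbK => /eqP.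
  have /eqP := congr1 (mcoeff (m - U_(j))) (dp0 j).
  rewrite mcoeff_deriv mcoeff0 submK ?lep1mP -?lt0n //.
  by rewrite -mulr_natr mulf_eq0 natr_pchar0_eq0 orbF => /eqP.
suff e : p = (p@_0)%:MP by move: Kp; rewrite e => /Kc ->; rewrite mpolyC0.
apply/mpolyP => m; rewrite mcoeffC; case: eqVneq => [<-|m0].
  by rewrite mulr1.
by rewrite mulr0 pm // eq_sym.
Qed.

Lemma poly_eq0_of_horner (u : {poly k}) : (forall t, u.[t] = 0) -> u = 0.
Proof.
move=> u0; apply/eqP; apply: contraT => un0.
have := @max_poly_roots k u [seq i%:R | i <- iota 0 (size u)] un0.
rewrite size_map size_iota ltnn; apply.
  by apply/allP => x _; rewrite rootE u0.
rewrite map_inj_uniq ?iota_uniq // => i j; wlog ij : i j / (i <= j)%N.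
  by move=> h; case/orP: (leq_total i j) => [/h//|/h h' /esym/h'].
move=> /eqP; rewrite eq_sym -subr_eq0 -natrB // natr_pchar0_eq0 subn_eq0 => ji.
by apply/eqP; rewrite eqn_leq ij.
Qed.

(** If [p] vanishes everywhere then so do its partial derivatives, as one sees by
restricting [p] to the lines parallel to the axes. *)
Lemma meval_eq0 n (p : {mpoly k[n]}) : (forall x, p.@[x] = 0) -> p = 0.
Proof.
apply: (@mderiv_closed_eq0 n (fun p => forall x, p.@[x] = 0)) => {p}; last first.
  by move=> c /(_ (fun=> 0)); rewrite mevalC.
move=> p i p0 x.
pose y j : {poly k} := (x j)%:P + 'X *+ (j == i).
have hy (q : {mpoly k[n]}) t :
    (mmap polyC y q).[t] = q.@[fun j => x j + t *+ (j == i)].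
  rewrite -horner_evalE rmorph_mmap; apply: eq_bigr => m _ /=.
  rewrite /horner_eval hornerC; congr (_ * _); apply: eq_bigr => j _ /=.
  by rewrite /horner_eval /y; case: eqP; rewrite !hornerE.
have u0 : mmap polyC y p = 0 by apply: poly_eq0_of_horner => t; rewrite hy.
have := @mmap_chain k {poly k} polyC n y deriv (@derivM _) (@derivC _) p.
rewrite u0 raddf0 (bigD1 i) //= big1 ?addr0 => [|j ji].
  rewrite /y eqxx derivD derivC derivX add0r mulr1 => /(congr1 (horner^~ 0)).
  rewrite hy horner0 => ->; apply: meval_eq => j.
  by rewrite mul0rn addr0.
by rewrite /y (negPf ji) addr0 derivC mulr0.
Qed.

(** Differentiating a relation [p(f) = 0] gives [(grad p)(f) * J = 0] where [J]
is the Jacobian matrix of [f]. As [det J] is nonzero at [a] it is a nonzero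
polynomial, so that the partial derivatives of [p] are relations as well. *)
Lemma jacobian_independent n (f : 'I_n -> {mpoly k[n]}) (a : 'I_n -> k) :
  (forall i j, (f i)^`M(j).@[a] = (i == j)%:R) ->
  forall p : {mpoly k[n]}, (forall x, p.@[fun i => (f i).@[x]] = 0) -> p = 0.
Proof.
move=> Jf; apply: mderiv_closed_eq0; last first.
  by move=> c /(_ (fun=> 0)); rewrite mevalC.
move=> p i p0 x.
pose J := \matrix_(i, j) (f i)^`M(j).
have detJ : \det J != 0.
  apply/eqP => /(congr1 (meval a)); rewrite meval0 -det_map_mx.
  suff -> : map_mx (meval a) J = 1%:M by rewrite det1 => /eqP; rewrite oner_eq0.
  by apply/matrixP => r s; rewrite !mxE Jf.
pose c q : {mpoly k[n]} := mmap (@mpolyC n k) f q.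
have ce q z : (c q).@[z] = q.@[fun i => (f i).@[z]].
  rewrite rmorph_mmap; apply: eq_bigr => m _ /=; rewrite mevalC.
  by congr (_ * _).
have cp0 : c p = 0 by apply: meval_eq0 => z; rewrite ce p0.
pose v := \row_j c p^`M(j).
have vJ : v *m J = 0.
  apply/rowP => j; rewrite !mxE.
  have := @mmap_chain k {mpoly k[n]} (@mpolyC n k) n f (mderiv j)
            (@mderivM _ _ j) (@mderivC _ _ j) p.
  rewrite -/(c p) cp0 raddf0 => e; rewrite [RHS]e.
  by apply: eq_bigr => l _; rewrite !mxE.
have /rowP/(_ i) : \det J *: v = 0.
  by rewrite -mul_mx_scalar -mul_mx_adj mulmxA vJ mul0mx.
rewrite !mxE => /eqP; rewrite mulf_eq0 (negPf detJ) /= => /eqP cp.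
by rewrite -ce cp meval0.
Qed.

End CharZero.

(** * Algebraic dependence by counting monomials *)

Section Dependence.
Variable k : fieldType.

Lemma msizeM_leS n (p q : {mpoly k[n]}) a b :
  (msize p <= a.+1)%N -> (msize q <= b.+1)%N -> (msize (p * q) <= (a + b).+1)%N.
Proof.
have [->|p0] := eqVneq p 0; first by rewrite mul0r msize0.
have [->|q0] := eqVneq q 0; first by rewrite mulr0 msize0.
move=> pa qb; rewrite msizeM // -ltnS prednK; last first.
  by rewrite addn_gt0 lt0n mmeasure_poly_eq0 p0.
by rewrite -addnS -addSn leq_add.
Qed.

Lemma msize_prodX_le n s (f : 'I_s -> {mpoly k[n]}) (alpha : 'I_s -> nat) :
  (msize (\prod_i f i ^+ alpha i) <=
    (\sum_i alpha i * msize (f i)).+1)%N.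
Proof.
elim/big_rec2: _ => [|i b p _ IH]; first by rewrite msize1.
apply: msizeM_leS => //; elim: (alpha i) => [|j IHj].
  by rewrite expr0 msize1.
by rewrite exprS mulSn; apply: msizeM_leS.
Qed.

Lemma leq_exp2rW a b n : (a <= b -> a ^ n <= b ^ n)%N.
Proof. by move=> ab; elim: n => // n IH; rewrite !expnS leq_mul. Qed.

(** There are [D ^ s] monomials in the [f i] with all exponents smaller than [D].
If [E] bounds the sum of the degrees, they involve at most [(D * E + 1) ^ n]
monomials in the variables, fewer than [D ^ s] when [D > (E + 1) ^ n]. *)
Lemma algebraic_dependence n s (f : 'I_s -> {mpoly k[n]}) : (n < s)%N ->
  exists2 p : {mpoly k[s]}, p != 0 & forall x, p.@[fun i => (f i).@[x]] = 0.
Proof.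
move=> ns; pose E := (\sum_i msize (f i))%N.
pose D := (E.+1 ^ n).+1; pose M := (D * E).+1.
pose T1 := {ffun 'I_s -> 'I_D}; pose T2 := {ffun 'I_n -> 'I_M}.
have lt21 : (#|T2| < #|T1|)%N.
  rewrite !card_ffun !card_ord.
  have h : (M <= D * E.+1)%N by rewrite mulnS (leq_add (_ : 1 <= D)%N).
  apply: leq_ltn_trans (_ : (D * E.+1) ^ n < _)%N; first exact: leq_exp2rW.
  rewrite expnMn; apply: leq_trans (_ : D ^ n.+1 <= _)%N; last first.
    by rewrite leq_pexp2l.
  by rewrite expnSr ltn_pmul2l ?expn_gt0.
pose mon (t : T1) := [multinom t i : nat | i < s].
pose g (t : T1) := \prod_i f i ^+ t i.
pose A := \matrix_(i < #|T1|, j < #|T2|)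
  (g (enum_val i))@_[multinom enum_val j l : nat | l < n].
(* a linear relation between the monomials in the [f i] *)
have [v vA v0] : exists2 v : 'rV_#|T1|, v *m A = 0 & v != 0.
  exists (nz_row (kermx A)); first by apply/sub_kermxP/nz_row_sub.
  rewrite nz_row_eq0 -mxrank_eq0 mxrank_ker subn_eq0 -ltnNge.
  exact: leq_ltn_trans (rank_leq_col _) lt21.
exists (\sum_i v 0 i *: 'X_[mon (enum_val i)]).
  apply: contraNneq v0 => p0; apply/eqP/rowP => i; rewrite mxE.
  have := congr1 (mcoeff (mon (enum_val i))) p0.
  rewrite mcoeff0 raddf_sum (bigD1 i) //= big1 ?addr0 => [|j ji].
    by rewrite mcoeffZ mcoeffX eqxx mulr1.
  rewrite mcoeffZ mcoeffX; case: eqP => [e|]; last by rewrite mulr0.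
  case/eqP: ji; apply: enum_val_inj; apply/ffunP => l; apply: val_inj.
  by have /mnmP/(_ l) := e; rewrite !mnmE.
have pg0 : \sum_i v 0 i *: g (enum_val i) = 0.
  apply/mpolyP => m; rewrite mcoeff0 raddf_sum /=.
  have [hm|hm] := boolP [forall l, m l < M]%N; last first.
    apply: big1 => i _; rewrite mcoeffZ.
    suff -> : (g (enum_val i))@_m = 0 by rewrite mulr0.
    apply/eqP; rewrite mcoeff_eq0; apply: msize_mdeg_ge.
    apply: leq_trans (msize_prodX_le _ _) _.
    have [l ml] : exists l, (M <= m l)%N.
      by move: hm; rewrite negb_forall => /existsP[l]; rewrite -leqNgt; exists l.
    apply: (@leq_trans M).
      rewrite ltnS /E big_distrr /=; apply: leq_sum => j _.
      by rewrite leq_mul2r ltnW ?orbT.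
    by apply: leq_trans ml _; rewrite mdegE (bigD1 l) //= leq_addr.
  pose t : T2 := [ffun l => inord (m l)].
  have /rowP/(_ (enum_rank t)) := vA; rewrite !mxE => e; rewrite -[RHS]e.
  apply: eq_bigr => i _; rewrite mcoeffZ mxE enum_rankK; congr (_ * _@__).
  apply/mnmP => l; rewrite mnmE ffunE inordK //.
  exact: (forallP hm l).
move=> x; rewrite raddf_sum -[RHS](meval0 x) -pg0 raddf_sum.
apply: eq_bigr => i _ /=.
rewrite !mevalZ mevalX rmorph_prod; congr (_ * _); apply: eq_bigr => l _.
by rewrite rmorphXn mnmE.
Qed.
End Dependence.

(** * Polynomial maps and their partial derivatives *)

Section PolyMaps.
Variables (k : fieldType) (m : nat).
Local Notation X := ('I_m -> k).

(** A polynomial function together with all its partial derivatives. A closure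
lemma for [spartials] or [partials] thus shows that a map is polynomial and
computes its differential at the same time. *)
Definition spartials (f : X -> k) (df : X -> 'I_m -> k) : Prop :=
  exists2 p : {mpoly k[m]}, forall x, f x = p.@[x] &
    forall a l, df a l = p^`M(l).@[a].

Lemma spartials_ext f df g dg : spartials f df -> f =1 g ->
  (forall a l, df a l = dg a l) -> spartials g dg.
Proof.
by move=> [p fp dfp] fg dfg; exists p => [x|a l]; rewrite -?fg -?dfg.
Qed.

Lemma spartials_poly (p : {mpoly k[m]}) :
  spartials (fun x => p.@[x]) (fun a l => p^`M(l).@[a]).
Proof. by exists p. Qed.

Lemma spartials_const c : spartials (fun=> c) (fun _ _ => 0).
Proof.
by exists c%:MP => *; rewrite ?mderivC ?mevalC ?meval0.
Qed.

Lemma spartialsX i : spartials (fun x => x i) (fun a l => (i == l)%:R).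
Proof.
exists 'X_i => *; first by rewrite mevalXU.
by rewrite mderivXU mevalC.
Qed.

Lemma spartialsD f df g dg : spartials f df -> spartials g dg ->
  spartials (fun x => f x + g x) (fun a l => df a l + dg a l).
Proof.
move=> [p fp dp] [q gq dq]; exists (p + q) => *; first by rewrite mevalD fp gq.
by rewrite mderivD mevalD dp dq.
Qed.

Lemma spartialsM f df g dg : spartials f df -> spartials g dg ->
  spartials (fun x => f x * g x) (fun a l => df a l * g a + f a * dg a l).
Proof.
move=> [p fp dp] [q gq dq]; exists (p * q) => *; first by rewrite mevalM fp gq.
by rewrite mderivM mevalD !mevalM dp dq fp gq.
Qed.

Lemma spartials_sum I (r : seq I) (f : I -> X -> k) df :
  (forall i, spartials (f i) (df i)) ->
  spartials (fun x => \sum_(i <- r) f i x) (fun a l => \sum_(i <- r) df i a l).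
Proof.
move=> h; elim: r => [|i r IH].
  by apply: spartials_ext (spartials_const 0) _ _ => [x|a l] /=; rewrite big_nil.
by apply: spartials_ext (spartialsD (h i) IH) _ _ => [x|a l] /=; rewrite big_cons.
Qed.

Lemma spartialsZ c f df : spartials f df ->
  spartials (fun x => f x * c) (fun a l => df a l * c).
Proof.
move=> h; apply: spartials_ext (spartialsM h (spartials_const c)) _ _ => [x|a l] //=.
by rewrite mulr0 addr0.
Qed.

Definition partials (T : vectType k) (F : X -> T) (dF : X -> 'I_m -> T) : Prop :=
  forall i, spartials (fun x => coords (F x) i) (fun a l => coords (dF a l) i).

Lemma coords_lin (T : vectType k) i a (u v : T) :
  coords (a *: u + v) i = a * coords u i + coords v i.
Proof. by rewrite /coords linearP. Qed.

Lemma sum_coords (T : vectType k) (v : T) :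
  v = \sum_i coords v i *: (vbasis {:T})`_i.
Proof. exact: coord_vbasis (memvf v). Qed.

Lemma coords_inj (T : vectType k) (u v : T) : coords u =1 coords v -> u = v.
Proof.
move=> uv; rewrite [u]sum_coords [v]sum_coords.
by apply: eq_bigr => i _; rewrite uv.
Qed.

Lemma partials_ext (T : vectType k) (F : X -> T) dF G dG :
  partials F dF -> F =1 G -> (forall a l, dF a l = dG a l) -> partials G dG.
Proof.
by move=> h FG dFG i; apply: spartials_ext (h i) _ _ => [x|a l]; rewrite -?FG -?dFG.
Qed.

Lemma partials_const (T : vectType k) (t : T) : partials (fun=> t) (fun _ _ => 0).
Proof.
move=> i; apply: spartials_ext (spartials_const _) _ _ => [x|a l] //=.
by rewrite /coords linear0.
Qed.

Lemma partialsD (T : vectType k) (F G : X -> T) dF dG :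
  partials F dF -> partials G dG ->
  partials (fun x => F x + G x) (fun a l => dF a l + dG a l).
Proof.
move=> hF hG i; apply: spartials_ext (spartialsD (hF i) (hG i)) _ _ => [x|a l] /=;
by rewrite /coords linearD.
Qed.

Lemma partials_sum (T : vectType k) I (r : seq I) (F : I -> X -> T) dF :
  (forall i, partials (F i) (dF i)) ->
  partials (fun x => \sum_(i <- r) F i x) (fun a l => \sum_(i <- r) dF i a l).
Proof.
move=> h j; apply: spartials_ext (spartials_sum r (fun i => h i j)) _ _ => [x|a l] /=;
by rewrite /coords linear_sum.
Qed.

Lemma partials_scale (T : vectType k) f df (G : X -> T) dG :
  spartials f df -> partials G dG ->
  partials (fun x => f x *: G x) (fun a l => df a l *: G a + f a *: dG a l).
Proof.
move=> hf hG i; apply: spartials_ext (spartialsM hf (hG i)) _ _ => [x|a l] /=;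
by rewrite /coords ?linearD ?linearZ.
Qed.

Lemma partials_functional (T : vectType k) (L : {scalar T}) (F : X -> T) dF :
  partials F dF -> spartials (fun x => L (F x)) (fun a l => L (dF a l)).
Proof.
move=> hF; have h := spartials_sum (index_enum 'I_(\dim {:T}))
    (fun i => spartialsZ (L (vbasis {:T})`_i) (hF i)).
apply: spartials_ext h _ _ => [x|a l] /=.
  rewrite [in RHS](sum_coords (F _)) linear_sum.
  by apply: eq_bigr => i _; rewrite linearZ.
rewrite [in RHS](sum_coords (dF _ _)) linear_sum.
by apply: eq_bigr => i _; rewrite linearZ.
Qed.

Lemma partials_lincomb (T : vectType k) (b : 'I_m -> T) :
  partials (fun x => \sum_i x i *: b i) (fun _ l => b l).
Proof.
have h := partials_sum (index_enum 'I_m)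
  (fun i => partials_scale (spartialsX i) (partials_const (b i))).
apply: partials_ext h _ _ => [//|a l] /=; rewrite (bigD1 l) //=.
rewrite big1 => [|i il]; first by rewrite eqxx scale1r scaler0 !addr0.
by rewrite (negPf il) scale0r scaler0 addr0.
Qed.

Lemma partials_lin (T T' : vectType k) (L : T -> T') (F : X -> T) dF :
  linear L -> partials F dF -> partials (fun x => L (F x)) (fun a l => L (dF a l)).
Proof.
move=> linL hF i.
pose L' := HB.pack_for {linear T -> T'} L (GRing.isLinear.Build k T T' *:%R L linL).
exact: (@partials_functional T (coord (vbasis {:T'}) i \o L') F dF).
Qed.

(** The product rule, for the universal bilinear map, evaluation. *)
Lemma partials_apply (U T : vectType k) (F : X -> 'Hom(U, T)) dF (G : X -> U) dG :
  partials F dF -> partials G dG ->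
  partials (fun x => F x (G x)) (fun a l => dF a l (G a) + F a (dG a l)).
Proof.
move=> hF hG.
have hb (j : 'I_(\dim {:U})) :
    partials (fun x => F x (vbasis {:U})`_j) (fun a l => dF a l (vbasis {:U})`_j).
  have lin : linear (fun f : 'Hom(U, T) => f (vbasis {:U})`_j).
    by move=> c u v; rewrite add_lfunE scale_lfunE.
  exact: (partials_lin lin hF).
have h := partials_sum (index_enum 'I_(\dim {:U}))
  (fun j => partials_scale (hG j) (hb j)).
apply: partials_ext h _ _ => [x|a l] /=.
  rewrite [in RHS](sum_coords (G x)) linear_sum.
  by apply: eq_bigr => j _; rewrite linearZ.
rewrite big_split /= addrC [in RHS](sum_coords (G a)) [in RHS](sum_coords (dG a l)).
rewrite !linear_sum.
by congr (_ + _); apply: eq_bigr => j _; rewrite linearZ.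
Qed.

(** A family of linear maps is polynomial as soon as its values are, since a linear
map is a sum of rank one maps built on its values at a basis. *)
Lemma partials_hom (U T : vectType k) (F : X -> 'Hom(U, T))
    (dF : X -> 'I_m -> 'Hom(U, T)) :
  (forall u, partials (fun x => F x u) (fun a l => dF a l u)) -> partials F dF.
Proof.
move=> h; pose R (j : 'I_(\dim {:U})) (t : T) : 'Hom(U, T) :=
  linfun (fun u => coords u j *: t).
have RE j t u : R j t u = coords u j *: t.
  by apply: linfun_lin => c v w; rewrite coords_lin scalerDl scalerA.
have Rlin j : linear (R j).
  move=> c u v; apply/lfunP => w.
  by rewrite add_lfunE scale_lfunE !RE scalerDr !scalerA mulrC.
have FE (f : 'Hom(U, T)) : f = \sum_j R j (f (vbasis {:U})`_j).
  apply/lfunP => u; rewrite sum_lfunE [in LHS](sum_coords u) linear_sum.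
  by apply: eq_bigr => j _; rewrite RE linearZ.
have h' := partials_sum (index_enum 'I_(\dim {:U}))
  (fun j => partials_lin (Rlin j) (h (vbasis {:U})`_j)).
by apply: partials_ext h' _ _ => [x|a l] /=; rewrite [RHS]FE.
Qed.

Definition polyfun (f : X -> k) := exists p : {mpoly k[m]}, forall x, f x = p.@[x].

Definition polymap (T : vectType k) (F : X -> T) :=
  forall i, polyfun (fun x => coords (F x) i).

Lemma polyfun_spartials f : polyfun f <-> exists df, spartials f df.
Proof.
split=> [[p fp]|[df [p fp _]]]; last by exists p.
by exists (fun a l => p^`M(l).@[a]); exists p.
Qed.

Lemma polymap_partials (T : vectType k) (F : X -> T) :
  polymap F <-> exists dF, partials F dF.
Proof.
split=> [h|[dF h] i]; last by have [p fp _] := h i; exists p.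
have [p hp] := choice h.
exists (fun a l => \sum_i (p i)^`M(l).@[a] *: (vbasis {:T})`_i) => i.
exists (p i) => // a l; rewrite /coords coord_sum_free //.
exact/basis_free/vbasisP.
Qed.

Lemma polyfunM f g : polyfun f -> polyfun g -> polyfun (fun x => f x * g x).
Proof. by move=> [p fp] [q gq]; exists (p * q) => x; rewrite mevalM fp gq. Qed.

Lemma polyfun_peval (T : vectType k) (F : X -> T) p :
  polymap F -> polyfun (fun x => peval p (F x)).
Proof.
move=> h; rewrite /peval; elim/mpoly_ind_ring: p => [c|i|p q IHp IHq|p q IHp IHq].
- by exists c%:MP => x; rewrite !mevalC.
- by have [p hp] := h i; exists p => x; rewrite mevalXU.
- have [p' hp] := IHp; have [q' hq] := IHq; exists (p' + q') => x.
  by rewrite !mevalD hp hq.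
- have [p' hp] := IHp; have [q' hq] := IHq; exists (p' * q') => x.
  by rewrite !mevalM hp hq.
Qed.

Hypothesis char0 : [pchar k] =i pred0.

(** Affine space is irreducible. *)
Lemma polyfun_mul_eq0 f g : polyfun f -> polyfun g ->
  (forall x, f x * g x = 0) -> (forall x, f x = 0) \/ (forall x, g x = 0).
Proof.
move=> [p fp] [q gq] fg; have /eqP : p * q = 0.
  by apply: (meval_eq0 char0) => x; rewrite mevalM -fp -gq.
by rewrite mulf_eq0 => /orP[]/eqP e; [left|right] => x; rewrite ?fp ?gq e meval0.
Qed.

Lemma partials_uniq (T : vectType k) (F : X -> T) dF dF' :
  partials F dF -> partials F dF' -> forall a l, dF a l = dF' a l.
Proof.
move=> h h' a l; apply: coords_inj => i.
have [p fp ->] := h i; have [q fq ->] := h' i.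
suff -> : p = q by [].
apply/eqP; rewrite -subr_eq0; apply/eqP/(meval_eq0 char0) => x.
by rewrite mevalB -fp -fq subrr.
Qed.

End PolyMaps.

Local Open Scope classical_set_scope.

(** * Irreducibility and constructible sets *)

Section ZariskiLemmas.
Variables (k : fieldType) (V : vectType k).
Local Notation dimV := (\dim {:V}).
Implicit Types (Z C : set V) (p q : {mpoly k[dimV]}).

Definition vanishes p Z := forall z, Z z -> peval p z = 0.

Lemma pevalM p q v : peval (p * q) v = peval p v * peval q v.
Proof. exact: mevalM. Qed.

(** Irreducible sets are those with a prime ideal: a closed set missing a point of
[Z] can be enlarged to the zero set of a single polynomial. *)
Lemma zirreducibleP Z : zirreducible Z <->
  Z !=set0 /\ (forall p q, vanishes (p * q) Z -> vanishes p Z \/ vanishes q Z).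
Proof.
split=> [[Z0 irr]|[Z0 prim]]; split=> //.
  move=> p q pq0.
  have h (r : {mpoly k[dimV]}) : zclosed [set v | peval r v = 0].
    by exists [set r]; apply/seteqP; split=> v /=; [move=> rv _ ->|apply].
  have [|hp|hq] := irr _ _ (h p) (h q); [|by left|by right].
  move=> z /pq0 /=; rewrite pevalM => /eqP.
  by rewrite mulf_eq0 => /orP[]/eqP; [left|right].
move=> C1 C2 [S1 ->] [S2 ->] ZC; apply: contrapT => /not_orP[].
move=> /existsNP[z1 /not_implyP[Zz1 /existsNP[p /not_implyP[Sp pz1]]]].
move=> /existsNP[z2 /not_implyP[Zz2 /existsNP[q /not_implyP[Sq qz2]]]].
have [z Zz|hp|hq] := prim p q; [|exact: (pz1 (hp _ Zz1))|exact: (qz2 (hq _ Zz2))].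
rewrite pevalM.
by have [/(_ _ Sp) ->|/(_ _ Sq) ->] := ZC _ Zz; rewrite ?mul0r ?mulr0.
Qed.

Definition zclosure Z : set V := zero_locus [set p | vanishes p Z].

Lemma zclosure_closed Z : zclosed (zclosure Z).
Proof. by exists [set p | vanishes p Z]. Qed.

Lemma sub_zclosure Z : Z `<=` zclosure Z.
Proof. by move=> z Zz p /(_ z Zz). Qed.

Lemma zclosure_min Z C : zclosed C -> Z `<=` C -> zclosure Z `<=` C.
Proof. by move=> [S ->] ZS v hv p Sp; apply: hv => z /ZS; apply. Qed.

Lemma zirreducible_closure Z : zirreducible Z -> zirreducible (zclosure Z).
Proof.
move=> /zirreducibleP[[z Zz] prim]; apply/zirreducibleP; split.
  by exists z; apply: sub_zclosure.
move=> p q h; have [|hp|hq] := prim p q.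
- by move=> y /sub_zclosure /h.
- by left=> y; apply.
- by right=> y; apply.
Qed.

Lemma zirreducible_image m (F : ('I_m -> k) -> V) : [pchar k] =i pred0 ->
  polymap F -> zirreducible (range F).
Proof.
move=> char0 pF; apply/zirreducibleP; split; first by exists (F (fun=> 0)), (fun=> 0).
move=> p q h.
have [x|hp|hq] := polyfun_mul_eq0 char0 (polyfun_peval p pF) (polyfun_peval q pF).
- by rewrite -pevalM; apply: h; exists x.
- by left=> _ [x _ <-].
- by right=> _ [x _ <-].
Qed.
End ZariskiLemmas.

Section Constructible.
Variables (k : closedFieldType) (V : vectType k).
Local Notation dimV := (\dim {:V}).

Lemma nth_codom_ord d (y : 'I_d -> k) (j : 'I_d) : (codom y)`_j = y j.
Proof. by rewrite codomE (nth_map j) ?size_enum_ord // nth_ord_enum. Qed.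

(** The variables numbered from 0 to [dim V - 1] stand for the coordinates of a
point of [V]; the other ones get the default value 0. *)
Lemma eval_codom_peval (t : GRing.term k) : GRing.rterm t ->
  exists p : {mpoly k[dimV]}, forall v : V,
    GRing.eval (codom (coords v)) t = peval p v.
Proof.
elim: t => //=.
- move=> i _; have [i_lt|i_ge] := ltnP i dimV; last first.
    by exists 0 => v; rewrite nth_default ?size_codom ?card_ord // /peval meval0.
  exists 'X_(Ordinal i_lt) => v; rewrite /peval mevalXU.
  by rewrite (nth_codom_ord _ (Ordinal i_lt)).
- by move=> c _; exists c%:MP => v; rewrite /peval mevalC.
- by move=> n _; exists n%:R => v; rewrite /peval -mpolyC_nat mevalC.
- move=> t1 IH1 t2 IH2 /andP[/IH1[p hp] /IH2[q hq]]; exists (p + q) => v.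
  by rewrite /peval mevalD hp hq.
- by move=> t IH /IH[p hp]; exists (- p) => v; rewrite /peval mevalN hp.
- by move=> t IH n /IH[p hp]; exists (p *+ n) => v; rewrite /peval mevalMn hp.
- move=> t1 IH1 t2 IH2 /andP[/IH1[p hp] /IH2[q hq]]; exists (p * q) => v.
  by rewrite /peval mevalM hp hq.
- by move=> t IH n /IH[p hp]; exists (p ^+ n) => v; rewrite /peval rmorphXn hp.
Qed.

Definition generically (Z : set V) (P : V -> Prop) :=
  exists2 p : {mpoly k[dimV]}, ~ vanishes p Z &
    forall z, Z z -> peval p z != 0 -> P z.

Lemma generically_and Z P Q : zirreducible Z -> generically Z P ->
  generically Z Q -> generically Z (fun z => P z /\ Q z).
Proof.
move=> /zirreducibleP[_ prim] [p p0 hp] [q q0 hq]; exists (p * q).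
  by move=> /prim[].
move=> z Zz; rewrite pevalM mulf_eq0 negb_or => /andP[pz qz].
by split; [apply: hp|apply: hq].
Qed.

Lemma generically_imp Z (P Q : V -> Prop) : (forall z, P z -> Q z) ->
  generically Z P -> generically Z Q.
Proof. by move=> PQ [p p0 hp]; exists p => // z Zz pz; apply/PQ/hp. Qed.

Lemma generically_all Z (P : V -> Prop) :
  zirreducible Z -> (forall z, Z z -> P z) -> generically Z P.
Proof.
move=> [[z Zz] _] ZP; exists 1 => [/(_ z Zz) /eqP|y Zy _]; last exact: ZP.
by rewrite /peval meval1 oner_eq0.
Qed.

(** On an irreducible set a polynomial equation holds either everywhere or nowhere
on a suitable nonempty open subset, and finitely many such subsets meet. *)
Lemma formula_generic Z (phi : GRing.formula k) : zirreducible Z ->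
  GRing.qf_form phi -> GRing.rformula phi ->
  exists b, generically Z (fun z => GRing.qf_eval (codom (coords z)) phi = b).
Proof.
move=> irr; elim: phi => //=.
- by move=> b _ _; exists b; apply: generically_all.
- move=> t1 t2 _ /andP[/eval_codom_peval[p hp] /eval_codom_peval[q hq]].
  have [h|h] := pselect (vanishes (p - q) Z).
    exists true; apply: generically_all => // z /h /eqP.
    by rewrite /peval mevalB subr_eq0 hp hq => ->.
  exists false, (p - q) => // z _; rewrite /peval mevalB subr_eq0 hp hq.
  exact: negPf.
- move=> f1 IH1 f2 IH2 /andP[q1 q2] /andP[r1 r2].
  have [[b1 h1] [b2 h2]] := (IH1 q1 r1, IH2 q2 r2); exists (b1 && b2).
  by apply: generically_imp (generically_and irr h1 h2) => z [-> ->].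
- move=> f1 IH1 f2 IH2 /andP[q1 q2] /andP[r1 r2].
  have [[b1 h1] [b2 h2]] := (IH1 q1 r1, IH2 q2 r2); exists (b1 || b2).
  by apply: generically_imp (generically_and irr h1 h2) => z [-> ->].
- move=> f1 IH1 f2 IH2 /andP[q1 q2] /andP[r1 r2].
  have [[b1 h1] [b2 h2]] := (IH1 q1 r1, IH2 q2 r2); exists (b1 ==> b2).
  by apply: generically_imp (generically_and irr h1 h2) => z [-> ->].
- move=> f IH q1 r1; have [b h] := IH q1 r1; exists (~~ b).
  by apply: generically_imp h => z ->.
Qed.

(** The shift by [d] leaves room for the [d] free variables of
[image_formula]. *)
Lemma mpoly_term d m (p : {mpoly k[m]}) : exists2 t : GRing.term k,
  GRing.rterm t & forall e, GRing.eval e t = p.@[fun i => e`_(d + i)].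
Proof.
elim/mpoly_ind_ring: p => [c|i|p q|p q].
- by exists (GRing.Const c) => // e; rewrite mevalC.
- by exists (GRing.Var _ (d + i)) => // e; rewrite mevalXU.
- move=> [t rt ht] [u ru hu]; exists (GRing.Add t u) => /=; first by rewrite rt.
  by move=> e; rewrite mevalD ht hu.
- move=> [t rt ht] [u ru hu]; exists (GRing.Mul t u) => /=; first by rewrite rt.
  by move=> e; rewrite mevalM ht hu.
Qed.

Lemma image_formula d m (h : {mpoly k[m]}) (f : 'I_d -> {mpoly k[m]}) :
  exists2 phi : GRing.formula k, GRing.rformula phi &
    forall y : 'I_d -> k, GRing.holds (codom y) phi <->
      exists2 x, h.@[x] != 0 & forall i, (f i).@[x] = y i.
Proof.
have [th rth hth] := mpoly_term d h.
have Htf i : exists t : GRing.term k, GRing.rterm t /\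
    forall e, GRing.eval e t = (f i).@[fun j => e`_(d + j)].
  by have [t rt ht] := mpoly_term d (f i); exists t.
have [tf htf] := choice Htf.
pose eqs s := foldr
  (fun i phi => GRing.And (GRing.Equal (tf i) (GRing.Var _ i)) phi)
  (GRing.Bool true) s.
have reqs s : GRing.rformula (eqs s).
  by elim: s => //= i s ->; rewrite (htf i).1.
have heqs e s : GRing.holds e (eqs s) <->
    forall i : 'I_d, i \in s -> (f i).@[fun j => e`_(d + j)] = e`_i.
  elim: s => //= i s IH; rewrite (htf i).2; split.
    by move=> [ei /IH es] j; rewrite inE => /orP[/eqP ->|/es].
  move=> h'; split; first by apply: h'; rewrite mem_head.
  by apply/IH => j js; apply: h'; rewrite inE js orbT.
pose phi0 :=
  GRing.And (GRing.Not (GRing.Equal th (GRing.Const 0))) (eqs (enum 'I_d)).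
exists (foldr GRing.Exists phi0 (iota d m)).
  by elim: (iota d m) => //=; rewrite rth reqs.
move=> y; rewrite -GRing.foldExistsP.
split=> [[e ey /= [/eqP he /heqs es]]|[x hx fx]].
  exists (fun j => e`_(d + j)); first by rewrite -hth.
  move=> i; rewrite es ?mem_enum // -ey ?nth_codom_ord //.
  by rewrite inE mem_iota /= leqNgt ltn_ord.
exists (codom y ++ codom x).
  move=> i; rewrite inE /= mem_iota nth_cat size_codom card_ord.
  have [id|di] //= := ltnP i d; rewrite -leqNgt => mi.
  rewrite !nth_default // size_codom card_ord // -(leq_add2l d) subnKC //.
have ex (j : 'I_m) : (codom y ++ codom x)`_(d + j) = x j.
  by rewrite nth_cat size_codom card_ord ltnNge leq_addr /= addKn nth_codom_ord.
split; first by apply/eqP; rewrite hth /= (meval_eq _ ex).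
apply/heqs => i _; rewrite (meval_eq _ ex) fx.
by rewrite nth_cat size_codom card_ord ltn_ord nth_codom_ord.
Qed.

(** Chevalley's theorem for a dominant map into an irreducible set. By quantifier
elimination the image generically has a constant truth value on [Z]. This value
is not false, for otherwise a polynomial not vanishing on [Z] would vanish on
the image, which is dense. *)
Lemma chevalley_generic (Z : set V) m (F : ('I_m -> k) -> V)
    (h : ('I_m -> k) -> k) :
  zirreducible Z -> polymap F -> polyfun h ->
  (forall x, h x != 0 -> Z (F x)) ->
  (forall p, (forall x, h x != 0 -> peval p (F x) = 0) -> vanishes p Z) ->
  generically Z (fun z => exists2 x, h x != 0 & F x = z).
Proof.
move=> irr pF [h' hh] FZ dense; have [f hf] := choice pF.
have [phi rphi hphi] := image_formula h' f.
pose QE := @GRing.quantifier_elim k (@ClosedFieldQE.ex_elim k).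
have QEP e : reflect (GRing.holds e phi) (GRing.qf_eval e (QE phi)).
  apply: GRing.quantifier_elim_rformP => //.
    exact: ClosedFieldQE.wf_ex_elim.
  by apply: ClosedFieldQE.holds_ex_elim; exact: solve_monicpoly.
have /andP[qfQ rQ] : GRing.qf_form (QE phi) && GRing.rformula (QE phi).
  by apply: GRing.quantifier_elim_wf => //; exact: ClosedFieldQE.wf_ex_elim.
have imP z : GRing.qf_eval (codom (coords z)) (QE phi) <->
    exists2 x, h x != 0 & F x = z.
  split=> [/QEP/hphi[x hx fx]|[x hx <-]].
    by exists x; rewrite ?hh //; apply: coords_inj => i; rewrite hf fx.
  by apply/QEP/hphi; exists x => [|i]; rewrite -?hh ?hf.
have [[] gen] := formula_generic irr qfQ rQ.
  by apply: generically_imp gen => z /imP.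
case: gen => p p0 hp; case: p0; apply: dense => x hx.
apply/eqP; apply: contraT => pz; have := hp _ (FZ _ hx) pz.
by rewrite (introT idP ((imP _).2 _)) //; exists x.
Qed.

End Constructible.

(** * Chains of irreducible closed sets *)

Section Chain.
Variables (k : fieldType) (V : vectType k).
Hypothesis char0 : [pchar k] =i pred0.
Local Notation dimV := (\dim {:V}).

(** For [i <= r], the inclusion of [k^i] in [k^r] as the first coordinates. *)
Definition pad r i (x : 'I_i -> k) (l : 'I_r) : k := oapp x 0 (insub (val l)).

Lemma spartials_pad r i (f : ('I_r -> k) -> k) df : spartials f df ->
  spartials (fun x : 'I_i -> k => f (pad x))
    (fun a l => \sum_(j < r | val j == val l) df (pad a) j).
Proof.
move=> [p fp dp].
pose y (l : 'I_r) : {mpoly k[i]} := oapp (fun j => 'X_j) 0 (insub (val l)).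
have ye q x : (mmap (@mpolyC i k) y q).@[x] = q.@[pad x].
  rewrite rmorph_mmap; apply: eq_bigr => m _ /=; rewrite mevalC; congr (_ * _).
  apply: eq_bigr => j _ /=; rewrite /y /pad; case: insubP => [u _ _|_] /=.
    by rewrite mevalXU.
  by rewrite meval0.
exists (mmap (@mpolyC i k) y p) => [x|a l]; first by rewrite fp ye.
have -> := @mmap_chain k {mpoly k[i]} (@mpolyC i k) r y (mderiv l)
            (@mderivM _ _ l) (@mderivC _ _ l) p.
rewrite raddf_sum /= big_mkcond; apply: eq_bigr => j _ /=.
rewrite mevalM ye -dp /y; case: insubP => [u _ uj|ji] /=.
  by rewrite mderivXU mevalC -uj -val_eqE /=; case: eqP; rewrite ?mulr1 ?mulr0.
rewrite mderiv0 meval0 mulr0 ifN //; apply: contraNneq ji => jl.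
by have := ltn_ord l; rewrite -[nat_of_ord l]jl.
Qed.

Lemma polymap_pad r i (T : vectType k) (F : ('I_r -> k) -> T) :
  polymap F -> polymap (fun x : 'I_i -> k => F (pad x)).
Proof.
move=> pF j; have /polyfun_spartials[df h] := pF j.
by apply/polyfun_spartials; eexists; apply: spartials_pad h.
Qed.

Lemma peval_functionals s (L : 'I_s -> {scalar V}) (P : {mpoly k[s]}) :
  exists p, forall v : V, peval p v = P.@[fun j => L j v].
Proof.
elim/mpoly_ind_ring: P => [c|j|p q|p q].
- by exists c%:MP => v; rewrite /peval !mevalC.
- exists (\sum_(l < dimV) (L j (vbasis {:V})`_l) *: 'X_l) => v.
  rewrite mevalXU /peval raddf_sum.
  rewrite [in RHS](sum_coords v) linear_sum; apply: eq_bigr => l _ /=.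
  by rewrite mevalZ mevalXU linearZ mulrC.
- by move=> [p' hp] [q' hq]; exists (p' + q') => v; rewrite /peval !mevalD -hp -hq.
- by move=> [p' hp] [q' hq]; exists (p' * q') => v; rewrite /peval !mevalM -hp -hq.
Qed.

Variables (r : nat) (F : ('I_r -> k) -> V) (dF : ('I_r -> k) -> 'I_r -> V).
Hypotheses (hF : partials F dF) (Ffree : free [tuple dF (fun=> 0) l | l < r]).

Definition flag_image i := zclosure (range (fun x : 'I_i -> k => F (pad x))).

Let polyF : polymap F. Proof. by apply/polymap_partials; exists dF. Qed.

Lemma flag_image_irr i : zirreducible (flag_image i).
Proof.
exact/zirreducible_closure/(zirreducible_image char0)/polymap_pad.
Qed.

Lemma flag_image_sub i : (i < r)%N -> flag_image i `<=` flag_image i.+1.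
Proof.
move=> ir; apply: zclosure_min; first exact: zclosure_closed.
move=> _ [x _ <-]; apply: sub_zclosure; exists (pad x) => //; congr F.
apply: funext => l; rewrite /pad.
case: insubP => [u _ /= ul|li] /=; first by rewrite ul.
by rewrite insubN //; apply: contra li => /leqW.
Qed.

(** Let [L] be the [i+1] first coordinate functions dual to the partial derivatives
of [F] at 0. A relation [P] between their restrictions to the image of [k^i]
would persist on the image of [k^(i+1)], where the Jacobian matrix of [L] is the
identity at 0. *)
Lemma flag_image_strict i : (i < r)%N -> ~ (flag_image i.+1 `<=` flag_image i).
Proof.
move=> ir sub; pose b := [tuple dF (fun=> 0) l | l < r].
pose w (j : 'I_i.+1) : 'I_r := widen_ord ir j.
pose L j : {scalar V} := coord b (w j).
have hL j : spartials (fun x => L j (F x)) (fun a l => L j (dF a l)).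
  exact: (partials_functional (L j) hF).
have [g hg] := choice (fun j => let: ex_intro2 p hp _ := spartials_pad i (hL j) in
  ex_intro (fun p => forall x, L j (F (pad x)) = p.@[x]) p hp).
have Hf j : exists f : {mpoly k[i.+1]}, (forall x, L j (F (pad x)) = f.@[x]) /\
    (forall l, f^`M(l).@[fun=> 0] = (j == l)%:R).
  have [p hp dp] := spartials_pad i.+1 (hL j); exists p; split=> // l.
  rewrite -dp (big_pred1 (w l)) /=; last by [].
  have -> : @pad r i.+1 (fun=> 0) = fun=> 0.
    by apply: funext => u; rewrite /pad; case: insub.
  have := coord_free (w l) (w j) Ffree.
  rewrite -tnth_nth tnth_mktuple => ->.
  by rewrite eq_sym -val_eqE.
have [f hf] := choice Hf.
have [P P0 hP] := algebraic_dependence g (ltnSn i).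
have [p hp] := peval_functionals L P.
case/eqP: P0; apply: (jacobian_independent char0 (fun j => (hf j).2)) => x.
have : flag_image i (F (pad x)) by apply/sub/sub_zclosure; exists x.
move=> /(_ p); rewrite hp => h; rewrite -[RHS]h; last first.
  move=> _ [y _ <-]; rewrite hp -[RHS](hP y); apply: meval_eq => j.
  exact: hg.
by apply: meval_eq => j; rewrite (hf j).1.
Qed.

Lemma has_chain_free_differential (Z : set V) : zclosed Z -> range F `<=` Z ->
  has_chain Z r.
Proof.
move=> cZ FZ; exists flag_image; split=> i ir; last first.
  by split; [exact: flag_image_sub|exact: flag_image_strict].
split; [exact: zclosure_closed|exact: flag_image_irr|].
by apply: zclosure_min => // _ [x _ <-]; apply: FZ; exists (pad x).
Qed.

End Chain.

Lemma has_chain_proper (k : fieldType) (V : vectType k) (Y Z : set V) r :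
  Y `<` Z -> zclosed Z -> zirreducible Z -> has_chain Y r -> has_chain Z r.+1.
Proof.
move=> [YZ ZY] cZ iZ [C [hC sC]].
exists (fun i => if (i <= r)%N then C i else Z); split=> i.
  move=> _; case: ifP => [/hC[? ? CY]|_]; last by split.
  by split=> //; exact: subset_trans YZ.
rewrite ltnS => ir'; have /orP[/eqP ->|ir] : (i == r) || (i < r)%N.
- by rewrite -leq_eqVlt.
- rewrite leqnn ltnn; have [_ _ CY] := hC r (leqnn r); split.
    exact: subset_trans YZ.
  by move=> ZC; apply: ZY; apply: subset_trans CY.
- by rewrite ir' ir; exact: sC.

Qed.

Import passmx.

(** * The polynomial parametrization of an orbit *)

Section Adjugate.
Variables (k : fieldType) (W : vectType k).
Local Notation e := (vbasis {:W}).

(** Determinant and adjugate of an endomorphism, read in a basis: they make the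
inverse polynomial up to a scalar. *)
Definition detl (g : 'End(W)) : k := \det (mxof e e g).
Definition adjl (g : 'End(W)) : 'End(W) := hommx e e (\adj (mxof e e g)).

Let eB : basis_of {:W} e := vbasisP _.

Lemma adjlK g x : adjl g (g x) = detl g *: x.
Proof.
rewrite hommxE // (@rVof_app _ _ _ e e eB) -mulmxA mul_mx_adj mul_mx_scalar.
by rewrite linearZ /= rVofK.
Qed.

Lemma detl1 : detl \1%VF = 1.
Proof. by rewrite /detl mxof1 ?det1 // (basis_free eB). Qed.

Lemma adjl1 x : adjl \1%VF x = x.
Proof. by rewrite -[X in adjl _ X](id_lfunE x) adjlK detl1 scale1r. Qed.

Lemma detl_neq0 g : detl g != 0 <-> @GL k W g.
Proof.
split=> [g0|gl].
  apply/lker0P => x y gxy; apply: (scalerI g0).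
  by rewrite -!adjlK gxy.
apply/eqP => g0; have gl' : lker g == 0%VS := gl.
have := detl1; rewrite -(lker0_compVf gl') /detl (@mxof_comp _ _ _ _ e e e eB).
rewrite det_mulmx.
by rewrite -/(detl g) g0 mul0r => /eqP; rewrite eq_sym oner_eq0.
Qed.

Lemma GL_inv_uniq (g f : 'End(W)) : @GL k W g -> cancel g f -> g^-1%VF = f.
Proof.
by move=> gl gf; apply/lfunP => y; rewrite -[in RHS](lker0_lfunVK gl y) gf.
Qed.

Lemma GL_adjl g y : @GL k W g -> adjl g y = detl g *: g^-1%VF y.
Proof. by move=> gl; rewrite -{1}(lker0_lfunVK gl y) adjlK. Qed.

Lemma GL_inv g : @GL k W g -> @GL k W g^-1%VF.
Proof.
by move=> gl; apply/lker0P; apply: can_inj (lker0_lfunVK gl).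
Qed.

Lemma GL_invK g : @GL k W g -> (g^-1^-1)%VF = g.
Proof.
move=> gl; apply: GL_inv_uniq; first exact: GL_inv.
exact: lker0_lfunVK.
Qed.

Lemma GL_scale c g : c != 0 -> @GL k W g -> @GL k W (c *: g).
Proof.
move=> c0 /lker0P gI; apply/lker0P => x y.
by rewrite !scale_lfunE => /(scalerI c0)/gI.
Qed.

Variables (m : nat) (g : ('I_m -> k) -> 'End(W)).
Hypothesis pg : polymap g.

Lemma mxof_polymap : exists P : 'M[{mpoly k[m]}]_(\dim {:W}),
  forall x, mxof e e (g x) = map_mx (meval x) P.
Proof.
have /polymap_partials[dg hg] := pg.
have h i j : exists p : {mpoly k[m]}, forall x, mxof e e (g x) i j = p.@[x].
  have hb := partials_apply hg (partials_const m e`_i).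
  have [p hp _] := partials_functional (coord e j) hb.
  by exists p => x; rewrite -hp mxE /= mxE vecof_delta.
have h' i : exists Pi : 'I_(\dim {:W}) -> {mpoly k[m]}, forall j x,
    mxof e e (g x) i j = (Pi j).@[x].
  by have [Pi hPi] := choice (h i); exists Pi.
have [P hP] := choice h'.
by exists (\matrix_(i, j) P i j) => x; apply/matrixP => i j; rewrite hP !mxE.
Qed.

Lemma polyfun_detl : polyfun (fun x => detl (g x)).
Proof.
have [P hP] := mxof_polymap; exists (\det P) => x.
by rewrite /detl hP det_map_mx.
Qed.

Lemma polymap_adjl : polymap (fun x => adjl (g x)).
Proof.
have [P hP] := mxof_polymap; apply/polymap_partials.
pose I := ('I_(\dim {:W}) * 'I_(\dim {:W}))%type.
have h := partials_sum (index_enum I) (fun ij : I => partials_scale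
  (spartials_poly (\adj P ij.1 ij.2))
  (partials_const m (hommx e e (delta_mx ij.1 ij.2)))).
eexists; apply: partials_ext h _ (fun _ _ => erefl) => x.
rewrite /adjl hP -map_mx_adj [in RHS](matrix_sum_delta (map_mx _ _)).
rewrite pair_big linear_sum; apply: eq_bigr => ij _ /=.
by rewrite linearZ [map_mx _ _ _ _]mxE.
Qed.

End Adjugate.

Section Twist.
Variables (k : fieldType) (W : vectType k).

(** For [h] inverse to [g1 = g2] this is the action of [h]; separating the three
arguments makes it linear in each of them, as its differential requires. *)
Definition twist (h g1 g2 : 'End(W)) (mu : bilop W) : bilop W :=
  bilin (fun x y => h (mu (g1 x) (g2 y))).

Lemma twistE h g1 g2 mu x y : twist h g1 g2 mu x y = h (mu (g1 x) (g2 y)).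
Proof.
apply: bilinE => [u|v] a b c /=; first by rewrite !linearP.
by rewrite !(linearP, add_lfunE, scale_lfunE).
Qed.

Lemma partials_eval m (g : ('I_m -> k) -> 'End(W)) dg u : partials g dg ->
  partials (fun x => g x u) (fun a l => dg a l u).
Proof.
move=> hg; apply: partials_ext (partials_apply hg (partials_const m u)) _ _ => [//|a l].
by rewrite linear0 addr0.
Qed.

Lemma partials_twist m (h g : ('I_m -> k) -> 'End(W)) dh dg mu :
  partials h dh -> partials g dg ->
  partials (fun x => twist (h x) (g x) (g x) mu)
    (fun a l => twist (dh a l) (g a) (g a) mu + twist (h a) (dg a l) (g a) mu
                + twist (h a) (g a) (dg a l) mu).
Proof.
move=> hh hg; apply: partials_hom => u; apply: partials_hom => v.
have lm : linear mu by move=> c u1 u2; rewrite linearP.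
have h1 := partials_apply hh
  (partials_apply (partials_lin lm (partials_eval u hg)) (partials_eval v hg)).
apply: partials_ext h1 _ _ => [x|a l]; first by rewrite twistE.
by rewrite !(add_lfunE, twistE) linearD addrA.
Qed.
End Twist.

Section OrbitMap.
Variables (k : fieldType) (W : vectType k) (A : {vspace bilop W}).
Local Notation V := (subvs_of A).
Implicit Types (g : 'End(W)) (mu : V).

(** As the scalar [t] acts on [mu] by [1 / t], this is the action on [mu] of the
inverse of [(s * detl g) *: g] when that scalar is nonzero. *)
Definition orbit_map (s : k) g mu : V :=
  vsproj A (twist (s *: adjl g) g g (vsval mu)).

Lemma orbit_map_act s g mu : s * detl g != 0 ->
  exists2 h, @GL k W h & orbit_map s g mu = act h mu.
Proof.
move=> c0; set c := s * detl g in c0.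
have gl : @GL k W g.
  by apply/detl_neq0; apply: contraNneq c0 => g0; rewrite /c g0 mulr0.
have gl' : @GL k W (c *: g) by exact: GL_scale.
exists (c *: g)^-1%VF; first exact: GL_inv.
congr vsproj; apply/lfunP => x; apply/lfunP => y.
rewrite bilop_actE GL_invK // twistE.
have -> : (c *: g)^-1%VF = c^-1 *: g^-1%VF.
  apply: GL_inv_uniq => // z; rewrite !scale_lfunE linearZ /= scalerA.
  rewrite mulVf // scale1r.
  by rewrite lker0_lfunK.
rewrite !scale_lfunE !linearZ /= scale_lfunE linearZ /= GL_adjl // !scalerA.
by rewrite mulVf // scale1r linearZ.
Qed.

Lemma act_orbit_map h mu : @GL k W h ->
  exists s g, s * detl g != 0 /\ orbit_map s g mu = act h mu.
Proof.
move=> gl; have gl' := GL_inv gl; have d0 := (detl_neq0 _).2 gl'.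
exists (detl h^-1%VF)^-1, h^-1%VF; split; first by rewrite mulVf ?oner_eq0.
congr vsproj; apply/lfunP => x; apply/lfunP => y.
rewrite bilop_actE twistE scale_lfunE GL_adjl // GL_invK // scalerA.
by rewrite mulVf // scale1r.
Qed.

Lemma partials_orbit_map m (s : ('I_m -> k) -> k) ds
    (g : ('I_m -> k) -> 'End(W)) dg dA mu :
  spartials s ds -> partials g dg -> partials (fun x => adjl (g x)) dA ->
  partials (fun x => orbit_map (s x) (g x) mu)
    (fun a l => vsproj A (
       twist (ds a l *: adjl (g a) + s a *: dA a l) (g a) (g a) (vsval mu)
       + twist (s a *: adjl (g a)) (dg a l) (g a) (vsval mu)
       + twist (s a *: adjl (g a)) (g a) (dg a l) (vsval mu))).
Proof.
move=> hs hg hA; apply: partials_lin; first by move=> c u1 u2; rewrite linearP.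
exact: partials_twist (partials_scale hs hA) hg.
Qed.

Lemma polymap_orbit_map m (s : ('I_m -> k) -> k) (g : ('I_m -> k) -> 'End(W)) mu :
  polyfun s -> polymap g -> polymap (fun x => orbit_map (s x) (g x) mu).
Proof.
move=> /polyfun_spartials[ds hs] pg; have /polymap_partials[dA hA] := polymap_adjl pg.
have /polymap_partials[dg hg] := pg; apply/polymap_partials.
by eexists; apply: partials_orbit_map hs hg hA.
Qed.

Hypothesis char0 : [pchar k] =i pred0.
Hypothesis hA : is_AW A.

(** The family [g = 1 + sum x_l xi_l] moves [adjl g] at 0 with the velocities
[tau_l - xi_l], where [tau_l] is the velocity of [detl g], as one sees by
differentiating [adjl g \o g = detl g]. Taking [s = 1 - sum x_l tau_l] leaves
[s *: adjl g] with the velocities [- xi_l], those of [g^-1]. *)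
Lemma orbit_map_directions mu r (xi : 'I_r -> 'End(W)) :
  exists (s : ('I_r -> k) -> k) (g : ('I_r -> k) -> 'End(W))
    (dF : ('I_r -> k) -> 'I_r -> V),
  [/\ polyfun s /\ polymap g, s (fun=> 0) = 1, g (fun=> 0) = \1%VF,
    partials (fun x => orbit_map (s x) (g x) mu) dF &
    forall l, dF (fun=> 0) l = - delta mu (xi l)].
Proof.
pose g (x : 'I_r -> k) := \1%VF + \sum_i x i *: xi i.
have hg : partials g (fun _ l => xi l).
  have h := partialsD (partials_const r (\1%VF : 'End(W))) (partials_lincomb xi).
  by apply: partials_ext h _ _ => [//|a l] /=; rewrite add0r.
have g0 : g (fun=> 0) = \1%VF.
  by rewrite /g big1 ?addr0 // => i _; rewrite scale0r.
have pg : polymap g by apply/polymap_partials; eexists; exact: hg.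
have /polymap_partials[dA hdA] := polymap_adjl pg.
have /polyfun_spartials[dD hdD] := polyfun_detl pg.
have dAE l : dA (fun=> 0) l = dD (fun=> 0) l *: \1%VF - xi l.
  apply/lfunP => u.
  have h1 := partials_apply hdA (partials_eval u hg).
  have h2 : partials (fun x => adjl (g x) (g x u)) _ :=
    partials_ext (partials_scale hdD (partials_const r u))
      (fun x => esym (adjlK (g x) u)) (fun _ _ => erefl).
  have := partials_uniq char0 h1 h2 (fun=> 0) l.
  rewrite g0 adjl1 id_lfunE scaler0 addr0 => e.
  by rewrite add_lfunE opp_lfunE scale_lfunE id_lfunE -e addrK.
pose s (x : 'I_r -> k) := 1 + \sum_i x i * (- dD (fun=> 0) i).
have hs : spartials s (fun _ l => - dD (fun=> 0) l).
  have h := spartialsD (spartials_const r 1)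
    (spartials_sum (index_enum 'I_r)
      (fun i => spartialsZ (- dD (fun=> 0) i) (spartialsX k i))).
  apply: spartials_ext h _ _ => [//|a l] /=; rewrite add0r (bigD1 l) //=.
  rewrite big1 => [|i il]; first by rewrite eqxx mul1r addr0.
  by rewrite (negPf il) mul0r.
have s0 : s (fun=> 0) = 1 by rewrite /s big1 ?addr0 // => i _; rewrite mul0r.
have hF := partials_orbit_map mu hs hg hdA.
exists s, g; eexists; split; [|exact: s0|exact: g0|exact: hF|].
  by split=> //; apply/polyfun_spartials; eexists; exact: hs.
move=> l /=; rewrite g0 s0 !scale1r.
suff -> : twist (- dD (fun=> 0) l *: adjl \1%VF + dA (fun=> 0) l)
      \1%VF \1%VF (vsval mu)
    + twist (adjl \1%VF) (xi l) \1%VF (vsval mu)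
    + twist (adjl \1%VF) \1%VF (xi l) (vsval mu) = - vsval (delta mu (xi l)).
  by rewrite -linearN vsvalK.
rewrite deltaE //; apply/lfunP => x; apply/lfunP => y.
rewrite !(add_lfunE, opp_lfunE, twistE, scale_lfunE, id_lfunE, adjl1).
rewrite bilop_inf_actE dAE add_lfunE opp_lfunE scale_lfunE id_lfunE scaleNr addKr.
by rewrite !opprD !opprK.
Qed.
End OrbitMap.

(** * The variety of algebras and its components *)

Section Points.
Variables (k : fieldType) (V : vectType k).
Local Notation dimV := (\dim {:V}).

Definition of_coords (x : 'I_dimV -> k) : V := \sum_i x i *: (vbasis {:V})`_i.

Lemma coordsK (v : V) : of_coords (coords v) = v.
Proof. by rewrite [RHS]sum_coords. Qed.

Lemma partials_of_coords : partials of_coords (fun _ l => (vbasis {:V})`_l).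
Proof. exact: partials_lincomb. Qed.

Lemma peval_linear (L : V -> V) p : linear L ->
  exists p', forall v, peval p' v = peval p (L v).
Proof.
move=> linL; have pL : polymap (fun x => L (of_coords x)).
  by apply/polymap_partials; eexists; apply: partials_lin linL partials_of_coords.
have [p' hp] := polyfun_peval p pL; exists p' => v.
by rewrite -[in RHS](coordsK v) hp.
Qed.

Lemma peval_quadratic (q : 'Hom(V, 'Hom(V, k^o))) : exists p : {mpoly k[dimV]},
  (forall v, peval p v = q v v) /\
  forall a v, \sum_(i < dimV) peval p^`M(i) a * coords v i = q v a + q a v.
Proof.
have hX := partials_of_coords.
have linq : linear q by move=> c u v; rewrite linearP.
have hq := partials_apply (partials_lin linq hX) hX.
have scal_id : scalar (id : k^o -> k) by [].
pose I := HB.pack_for {scalar k^o} (id : k^o -> k)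
  (GRing.isLinear.Build k k^o k *%R id scal_id).
have [p hp dp] := partials_functional I hq; exists p; split=> [v|a v].
  by rewrite /peval -hp /= coordsK.
rewrite [in RHS](sum_coords v) !linear_sum sum_lfunE -big_split.
apply: eq_bigr => i _; rewrite /peval -dp /= coordsK.
by rewrite !linearZ scale_lfunE mulrDl ![_ * coords v i]mulrC.
Qed.

End Points.

Section Action.
Variables (k : fieldType) (W : vectType k) (A : {vspace bilop W}).
Hypothesis hA : is_AW A.
Local Notation V := (subvs_of A).

Lemma act_linear g : linear (@act k W A g).
Proof.
move=> c u v; rewrite /act -linearP; congr (vsproj A _).
apply/lfunP => x; apply/lfunP => y.
by rewrite !(add_lfunE, scale_lfunE, bilop_actE, linearP).
Qed.

Lemma GL1 : @GL k W \1%VF.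
Proof. by apply/lker0P => x y; rewrite !id_lfunE. Qed.

Lemma GL_comp g h : @GL k W g -> @GL k W h -> @GL k W (g \o h)%VF.
Proof.
by move=> /lker0P gI /lker0P hI; apply/lker0P => x y; rewrite !comp_lfunE => /gI/hI.
Qed.

Lemma act1 (v : V) : act \1%VF v = v.
Proof.
apply: subvs_inj; rewrite val_act //; apply/lfunP => x; apply/lfunP => y.
rewrite bilop_actE; have -> : (\1^-1)%VF = \1%VF :> 'End(W).
  by apply: GL_inv_uniq; [exact: GL1|move=> z; rewrite !id_lfunE].
by rewrite !id_lfunE.
Qed.

Lemma act_comp g h (v : V) : @GL k W g -> @GL k W h ->
  act g (act h v) = act (g \o h)%VF v.
Proof.
move=> gG hG; apply: subvs_inj; rewrite !val_act //.
apply/lfunP => x; apply/lfunP => y; rewrite !bilop_actE.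
have -> : ((g \o h)^-1)%VF = (h^-1 \o g^-1)%VF.
  apply: GL_inv_uniq; first exact: GL_comp.
  by move=> z; rewrite !comp_lfunE !lker0_lfunK.
by rewrite !comp_lfunE.
Qed.

Lemma actK g (v : V) : @GL k W g -> act g^-1%VF (act g v) = v.
Proof. by move=> gG; rewrite act_comp ?lker0_compVf ?act1 //; exact: GL_inv. Qed.

(** The pairs [(s, g)] as the points of an affine space, the coordinate of index 0
being [s]. *)
Definition param_scalar (x : 'I_(\dim {:'End(W)}).+1 -> k) : k := x ord0.
Definition param_endo (x : 'I_(\dim {:'End(W)}).+1 -> k) : 'End(W) :=
  of_coords (fun i => x (lift ord0 i)).

Lemma polyfun_param_scalar : polyfun param_scalar.
Proof. by exists 'X_ord0 => x; rewrite mevalXU. Qed.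

Lemma polymap_param_endo : polymap param_endo.
Proof.
apply/polymap_partials; eexists; apply: partials_sum => i.
exact: partials_scale (spartialsX k (lift ord0 i)) (partials_const _ _).
Qed.

Lemma param_surj s g : exists x, param_scalar x = s /\ param_endo x = g.
Proof.
exists (fun i => if unlift ord0 i is Some j then coords g j else s); split.
  by rewrite /param_scalar unlift_none.
rewrite -[RHS]coordsK; congr of_coords; apply: funext => i.
by rewrite liftK.
Qed.

Definition param_map (mu : V) x : V := orbit_map (param_scalar x) (param_endo x) mu.
Definition param_unit x : k := param_scalar x * detl (param_endo x).

Lemma polymap_param_map mu : polymap (param_map mu).
Proof. exact: polymap_orbit_map polyfun_param_scalar polymap_param_endo. Qed.

Lemma polyfun_param_unit : polyfun param_unit.
Proof. exact: polyfunM polyfun_param_scalar (polyfun_detl polymap_param_endo). Qed.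

Lemma param_map_orbit mu v :
  GL_orbit mu v <-> exists2 x, param_unit x != 0 & param_map mu x = v.
Proof.
split=> [[g gG <-]|[x /(orbit_map_act mu)[g gG e] <-]]; last by exists g.
have [s [h [sh <-]]] := act_orbit_map mu gG.
by have [x [xs xh]] := param_surj s h; exists x; rewrite /param_unit /param_map xs xh.
Qed.

Hypothesis char0 : [pchar k] =i pred0.

(** An orbit is the image of a nonempty open subset of an affine space, hence it is
irreducible. *)
Lemma orbit_prime (mu : V) p q : vanishes (p * q) (GL_orbit mu) ->
  vanishes p (GL_orbit mu) \/ vanishes q (GL_orbit mu).
Proof.
move=> pq; have pP r := polyfun_peval r (polymap_param_map mu).
have [x|hp|hq] := polyfun_mul_eq0 char0 (polyfunM polyfun_param_unit (pP p)) (pP q).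
- have [->|x0] := eqVneq (param_unit x) 0; first by rewrite !mul0r.
  by rewrite -mulrA -pevalM pq ?mulr0 //; apply/param_map_orbit; exists x.
- left=> v /param_map_orbit[x x0 <-]; have /eqP := hp x.
  by rewrite mulf_eq0 (negPf x0) => /eqP.
- by right=> v /param_map_orbit[x x0 <-].
Qed.

Lemma orbit_map_closed (Z : set V) m s g (mu : V) x0 :
  zclosed Z -> GL_orbit mu `<=` Z -> polyfun s -> polymap g ->
  s x0 * detl (g x0) != 0 ->
  forall x : 'I_m -> k, Z (orbit_map (s x) (g x) mu).
Proof.
move=> [S ->] OZ ps pg h0 x p Sp.
have pP := polyfun_peval p (polymap_orbit_map mu ps pg).
have [y|hu|] := polyfun_mul_eq0 char0 (polyfunM ps (polyfun_detl pg)) pP.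
- have [->|y0] := eqVneq (s y * detl (g y)) 0; first by rewrite mul0r.
  have [h hG ->] := orbit_map_act mu y0.
  by rewrite (OZ _ _ p Sp) ?mulr0 //; exists h.
- by rewrite hu eqxx in h0.
- exact.
Qed.

Variable Q : {vspace bilform A}.
Hypothesis Qstable : GL_stable Q.

Lemma VarQ_closed : zclosed (VarQ Q).
Proof.
exists [set p | exists2 q, q \in Q & forall v, peval p v = q v v].
apply/seteqP; split=> v /=; first by move=> hv p [q /hv qv ->].
move=> hv q qQ; have [p [hp _]] := peval_quadratic q.
by rewrite -hp; apply: hv; exists q.
Qed.

Lemma VarQ_act g v : @GL k W g -> VarQ Q v -> VarQ Q (act g v).
Proof.
move=> gG hv q qQ; have := hv _ (Qstable (GL_inv gG) qQ).
by rewrite bilform_actE GL_invK.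
Qed.

Section Component.
Variable Z : set V.
Hypothesis hZ : irreducible_component (VarQ Q) Z.

Lemma component_closed : zclosed Z.
Proof.
have [ZX irr maxZ] := hZ.
rewrite -(maxZ (zclosure Z)); first exact: zclosure_closed.
- exact: zclosure_min VarQ_closed ZX.
- exact: zirreducible_closure.
- exact: sub_zclosure.
Qed.

(** The union of the translates of [Z] is irreducible. Otherwise, let [p * q] vanish
on it while [p (g1 z1)] and [q (g2 z2)] are nonzero. As [Z] is irreducible, there
is one point [y] of [Z] with [p (g1 y)] and [q (g2 y)] both nonzero, which
contradicts the irreducibility of the orbit of [y]. *)
Lemma component_act g z : @GL k W g -> Z z -> Z (act g z).
Proof.
have [ZX irr maxZ] := hZ => gG Zz.
pose GZ := [set v | exists2 z, Z z & GL_orbit z v].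
have sub : Z `<=` GZ.
  by move=> y Zy; exists y => //; exists \1%VF; [exact: GL1|exact: act1].
suff <- : GZ = Z by exists z => //; exists g.
apply: maxZ => //; first by move=> _ [y /ZX Xy [h hG <-]]; exact: VarQ_act.
have [[z0 Zz0] prim] := (zirreducibleP _).1 irr.
apply/zirreducibleP; split=> [|p q pq]; first by exists z0; exact: sub.
apply: contrapT => /not_orP[].
move=> /existsNP[_ /not_implyP[[z1 Zz1 [g1 g1G <-]] pz1]].
move=> /existsNP[_ /not_implyP[[z2 Zz2 [g2 g2G <-]] qz2]].
have [p1 hp1] := peval_linear p (act_linear g1).
have [q2 hq2] := peval_linear q (act_linear g2).
have [y Zy|h|h] := prim p1 q2; last 2 first.
- by apply: pz1; rewrite -hp1 h.
- by apply: qz2; rewrite -hq2 h.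
rewrite pevalM hp1 hq2.
have [v Ov|h|h] := @orbit_prime y p q.
- by apply: pq; exists y.
- by rewrite h ?mul0r //; exists g1.
- by rewrite [X in _ * X]h ?mulr0 //; exists g2.
Qed.

(** The Zariski tangent space of [Z] lies in that of the scheme Var(Q), which is the
kernel of [Phi]. *)
Lemma tangent_vector_Phi mu v : (forall q, q \in Q -> symmetric_bilform q) ->
  tangent_vector Z mu v -> Phi Q mu v = 0.
Proof.
move=> Qsym tv; apply/lfunP => q; rewrite PhiE zero_lfunE.
have [p [hp dp]] := peval_quadratic (vsval q).
have [ZX _ _] := hZ.
have := tv p; rewrite dp (Qsym _ (subvsP q)) -mulr2n -mulr_natl => h.
have /eqP : 2%:R * vsval q mu v = 0.
  by apply: h => z /ZX Xz; rewrite hp Xz ?subvsP.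
by rewrite mulf_eq0 natr_pchar0_eq0 // => /eqP.
Qed.

End Component.
End Action.

(** * Density and openness of the orbit *)

Section Density.
Variables (k : fieldType) (W : vectType k) (A : {vspace bilop W}).
Hypotheses (hA : is_AW A) (char0 : [pchar k] =i pred0).
Local Notation V := (subvs_of A).

(** The basis vectors of [T] are taken as the partial derivatives at 0 of a
polynomial family inside the orbit closure, which gives the latter a chain as
long as those of [Z]. *)
Lemma orbit_dense (Z : set V) (mu : V) (T : {vspace V}) :
  zclosed Z -> zirreducible Z -> GL_orbit mu `<=` Z -> krull_dim Z (\dim T) ->
  (T <= limg (delta mu))%VS -> Z `<=` zclosure (GL_orbit mu).
Proof.
move=> cZ iZ OZ [_ maxZ] TD; set C := zclosure (GL_orbit mu).
apply: contrapT => ZC.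
have CZ : C `<` Z by split => //; exact: zclosure_min.
suff /(has_chain_proper CZ cZ iZ)/maxZ : has_chain C (\dim T) by rewrite ltnn.
pose xi l := - (delta mu)^-1%VF (tnth (vbasis T) l).
have [s [g [dF [[ps pg] s0 g0 hF dF0]]]] := orbit_map_directions char0 hA mu xi.
apply: (has_chain_free_differential char0 hF); last first.
- move=> _ [x _ <-].
  apply: (orbit_map_closed char0 (x0 := fun=> 0)) => //.
  + exact: zclosure_closed.
  + exact: sub_zclosure.
  + by rewrite s0 g0 detl1 mulr1 oner_eq0.
- exact: zclosure_closed.
suff -> : [tuple dF (fun=> 0) l | l < \dim T] = vbasis T.
  exact/basis_free/vbasisP.
apply: eq_from_tnth => l; rewrite tnth_mktuple dF0 /xi linearN opprK.
rewrite /= limg_lfunVK //; apply: (subvP TD); apply/vbasis_mem/mem_tnth.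
Qed.

End Density.

(** The open set is the union of all the principal open subsets whose trace on [Z]
lies in the orbit; it contains the orbit because the action carries a point with
such a neighbourhood to any other point of the orbit. *)
Lemma dense_orbit_open (k : closedFieldType) (char0 : [pchar k] =i pred0)
    (W : vectType k) (A : {vspace bilop W}) (hA : is_AW A)
    (Z : set (subvs_of A)) (mu : subvs_of A) :
  zirreducible Z -> (forall g z, @GL k W g -> Z z -> Z (act g z)) ->
  Z mu -> Z `<=` zclosure (GL_orbit mu) ->
  zopen_in Z (GL_orbit mu).
Proof.
move=> iZ actZ Zmu ZO.
have OZ : GL_orbit mu `<=` Z by move=> _ [g gG <-]; exact: actZ.
have [p0 p0Z hp0] : generically Z (GL_orbit mu).
  apply: generically_imp (chevalley_generic iZ (polymap_param_map mu)
    (@polyfun_param_unit k W) _ _) => [z /param_map_orbit //|x x0|p hp z Zz].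
    by apply: OZ; apply/param_map_orbit; exists x.
  by apply: (ZO _ Zz) => v /param_map_orbit[x /hp px <-].
have [_ [[g0 g0G <-] pv0]] : exists v, GL_orbit mu v /\ peval p0 v != 0.
  apply: contrapT => /forallNP h; apply: p0Z => z /ZO; apply => v Ov.
  by apply/eqP; apply: contraT => pv; case: (h v).
pose S := [set p | forall z, Z z -> peval p z != 0 -> GL_orbit mu z].
exists (~` zero_locus S); first by rewrite /zopen setCK; exists S.
apply/seteqP; split=> v /=; last first.
  move=> [/existsNP[p /not_implyP[Sp /eqP pv]] Zv]; exact: Sp.
move=> Ov; split; last exact: OZ.
have [g gG <-] := Ov; pose c := (g0 \o g^-1)%VF.
have cG : @GL k W c by apply: GL_comp => //; exact: GL_inv.
have [p hp] := peval_linear p0 (@act_linear k W A c).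
move=> /(_ p); rewrite hp act_comp //.
have -> : (c \o g)%VF = g0.
  by apply/lfunP => x; rewrite !comp_lfunE lker0_lfunK.
move=> h; case/eqP: pv0; apply: h => z Zz.
rewrite hp => /(hp0 _ (actZ _ _ cG Zz)) [h hG hz].
exists (c^-1 \o h)%VF; first by apply: GL_comp => //; exact: GL_inv.
by rewrite -act_comp // ?hz ?actK //; exact: GL_inv.
Qed.

Theorem theorem2p8 (k : closedFieldType) (char0 : [pchar k] =i pred0)
    (W : vectType k) (A : {vspace bilop W}) (hA : is_AW A)
    (Q : {vspace bilform A}) (Qsym : forall q, q \in Q -> symmetric_bilform q)
    (Qstable : GL_stable Q)
    (Z : set (subvs_of A)) (hZ : irreducible_component (VarQ Q) Z)
    (mu : subvs_of A) (hmu : constant_rank_locus Q Z mu)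
    (hH2 : H2inc Q mu = 0%VS) :
  zopen_in Z (GL_orbit mu).
Proof.
have [[Zmu [T TP dimT]] _ _] := hmu; have [_ irrZ _] := hZ.
have actZ g z : @GL k W g -> Z z -> Z (act g z).
  exact: (component_act hA char0 Qstable hZ).
apply: dense_orbit_open => //; apply: (orbit_dense hA char0 _ irrZ _ dimT).
- exact: component_closed hZ.
- by move=> _ [g gG <-]; exact: actZ.
apply/subvP => v /TP tv; apply: (subvP (_ : lker (Phi Q mu) <= _)%VS).
  by rewrite -diffv_eq0; apply/eqP; exact: hH2.
by rewrite memv_ker; apply/eqP; exact: tangent_vector_Phi tv.
Qed.
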